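(* Let $M$ be a monoid and let $D:M\to\mathsf{PS(Stoch)}$ be a dynamical system acting on a probability space $(X,p)$. Then an invariant object $(X_{\mathrm{inv}},p_{\mathrm{inv}})$ for $D$ exists in $\mathsf{PS(Stoch)}$, and it is given by the underlying set of $X$ equipped with the invariant $\sigma$-algebra of $D$ (with $p_{\mathrm{inv}}$ the restriction of $p$ to the invariant $\sigma$-algebra, and with $r:(X,p)\to(X_{\mathrm{inv}},p_{\mathrm{inv}})$ the kernel induced by the set-theoretic identity, $r(B|x)=1_B(x)$).
   Context: A Markov kernel $k:X\to Y$ between measurable spaces assigns to $x\in X$ and measurable $B\subseteq Y$ a number $k(B|x)\in[0,1]$, being a probability measure in $B$ and measurable in $x$; composition is $(h\circ k)(C|x)=\int_Y h(C|y)\,k(dy|x)$, and identities are $(B,x)\mapsto 1_B(x)$. $\mathsf{Stoch}$ is the category of measurable spaces and Markov kernels. For a probability measure $p$ on $X$, kernels $f,g:X\to Y$ are $p$-almost surely equal, $f\simeq_p g$, if $\int_A f(B|x)\,p(dx)=\int_A g(B|x)\,p(dx)$ for all measurable $A\subseteq X$, $B\subseteq Y$. The category $\mathsf{PS(Stoch)}$ has probability spaces $(X,p)$ as objects; morphisms $(X,p)\to(Y,q)$ are $p$-a.s. equality classes of Markov kernels $f:X\to Y$ with $q(B)=\int_X f(B|x)\,p(dx)$ for all measurable $B$. A kernel $f:X\to Y$ is $p$-almost surely deterministic if for all measurable $A\subseteq X$ and $B,B'\subseteq Y$, $\int_A f(B\cap B'|x)\,p(dx)=\int_A f(B|x)f(B'|x)\,p(dx)$.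 A dynamical system $D:M\to\mathsf{PS(Stoch)}$ acting on $(X,p)$ is a functor from the monoid $M$ (as a one-object category) sending the single object to $(X,p)$; the morphism $(X,p)\to(X,p)$ induced by $m\in M$ is again denoted $m$. A morphism $f:(X,p)\to(Y,q)$ is $p$-a.s. (right-)invariant if $f\circ m\simeq_p f$ for all $m\in M$. An invariant object for $D$ is an object $(X_{\mathrm{inv}},p_{\mathrm{inv}})$ with a morphism $r:(X,p)\to(X_{\mathrm{inv}},p_{\mathrm{inv}})$ such that: (i) it is a colimit of $D$ in $\mathsf{PS(Stoch)}$: $r\circ m\simeq_p r$ for all $m$, and for every $p$-a.s. invariant $f:(X,p)\to(Y,q)$ there is a unique (up to $p_{\mathrm{inv}}$-a.s. equality) morphism $\tilde f:(X_{\mathrm{inv}},p_{\mathrm{inv}})\to(Y,q)$ with $\tilde f\circ r\simeq_p f$; (ii) in this situation $f$ is $p$-a.s. deterministic if and only if $\tilde f$ is $p_{\mathrm{inv}}$-a.s. deterministic. A measurable subset $A\subseteq X$ is invariant if for every $m\in M$, $m(A|x)=1_A(x)$ for $p$-almost all $x$, i.e. $\int_B m(A|x)\,p(dx)=p(A\cap B)$ for every measurable $B\subseteq X$. Invariant sets form a $\sigma$-algebra, called the invariant $\sigma$-algebra. *)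

(* Defs.v *)
From HB Require Import structures.
From mathcomp Require Import all_boot all_order all_algebra.
From mathcomp Require Import all_classical all_reals all_analysis.
From mathcomp Require Import measurable_realfun kernel.

Set Implicit Arguments.
Unset Strict Implicit.
Unset Printing Implicit Defensive.

Import Order.TTheory GRing.Theory Num.Theory.

Local Open Scope classical_set_scope.
Local Open Scope ring_scope.
Local Open Scope ereal_scope.

(* [mkcomp_noparam k h] is the composite h \o k; the library only knows that
   it is a subprobability kernel. *)
Section markov_composition.
Context d0 d1 d2 (X : measurableType d0) (Y : measurableType d1)
  (Z : measurableType d2) (R : realType).
Variables (k : R.-pker X ~> Y) (h : R.-pker Y ~> Z).

Let prob_mkcomp x : mkcomp_noparam k h x [set: Z] = 1.
Proof.
rewrite /mkcomp_noparam /= /kcomp_noparam.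
under eq_integral do rewrite prob_kernel.
by rewrite integral_cst// mul1e prob_kernel.
Qed.

HB.instance Definition _ := isProbabilityKernel.Build _ _ _ _ R
  (mkcomp_noparam k h) prob_mkcomp.

End markov_composition.

(* Hom-sets of PS(Stoch) are treated as setoids: a morphism is given by a
   representing Markov kernel and equality of morphisms is [as_eq]. An object
   (X, p) is given by the probability p alone. Library measurable spaces are
   pointed, which excludes only the empty space, on which there is no
   probability measure. *)
Definition as_eq d d' (X : measurableType d) (Y : measurableType d')
    (R : realType) (p : probability X R) (f g : R.-pker X ~> Y) : Prop :=
  forall (A : set X) (B : set Y), measurable A -> measurable B ->
    \int[p]_(x in A) f x B = \int[p]_(x in A) g x B.

Record PS_hom d d' (X : measurableType d) (Y : measurableType d')
    (R : realType) (p : probability X R) (q : probability Y R) := PSHom {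
  PS_kernel :> R.-pker X ~> Y;
  PS_preserve : forall B : set Y, measurable B ->
    q B = \int[p]_x PS_kernel x B }.

Lemma integral_PS_hom d d' (X : measurableType d) (Y : measurableType d')
    (R : realType) (p : probability X R) (q : probability Y R)
    (f : PS_hom p q) (h : Y -> \bar R) :
  (forall y, 0 <= h y) -> measurable_fun [set: Y] h ->
  \int[q]_y h y = \int[p]_x \int[f x]_y h y.
Proof.
move=> h0 mh.
pose l : R.-pker X ~> X := kprobability (measurable_cst (p : pprobability X R)).
pose k : R.-spker (X * X)%type ~> Y := kernel.kernel_snd f.
transitivity (\int[kcomp l k point]_y h y); last by rewrite integral_kcomp.
apply: eq_measure_integral => A mA _; exact: PS_preserve.
Qed.

Section PS_category.
Context d d' d'' (X : measurableType d) (Y : measurableType d')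
  (Z : measurableType d'') (R : realType).
Variables (p : probability X R) (q : probability Y R) (s : probability Z R).

Let id_kernel : R.-pker X ~> X := kdirac (@measurable_id _ X setT).

Let id_preserve B : measurable B -> p B = \int[p]_x id_kernel x B.
Proof. by move=> mB; rewrite /= /dirac integral_indic// setIT. Qed.

Definition PS_id : PS_hom p p := PSHom id_preserve.

Variables (g : PS_hom q s) (f : PS_hom p q).

Let comp_kernel : R.-pker X ~> Z := mkcomp_noparam f g.

Let comp_preserve C : measurable C -> s C = \int[p]_x comp_kernel x C.
Proof.
move=> mC; rewrite (PS_preserve g)// (integral_PS_hom f)//.
exact: measurable_kernel.
Qed.

Definition PS_comp : PS_hom p s := PSHom comp_preserve.

End PS_category.
Arguments PS_id {d X R} p.

Definition as_deterministic d d' (X : measurableType d) (Y : measurableType d')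
    (R : realType) (p : probability X R) (f : R.-pker X ~> Y) : Prop :=
  forall (A : set X) (B B' : set Y),
    measurable A -> measurable B -> measurable B' ->
    \int[p]_(x in A) f x (B `&` B') = \int[p]_(x in A) (f x B * f x B').

(* A functor from M, as a one-object category, with D(mn) = D(m) \o D(n). *)
Record dynamical_system (M : monoidType) d (X : measurableType d)
    (R : realType) (p : probability X R) := DynamicalSystem {
  dyn :> M -> PS_hom p p;
  dyn1 : as_eq p (dyn 1%g) (PS_id p);
  dynM : forall m n : M, as_eq p (dyn (m * n)%g) (PS_comp (dyn m) (dyn n)) }.

Definition as_invariant (M : monoidType) d d' (X : measurableType d)
    (Y : measurableType d') (R : realType) (p : probability X R)
    (q : probability Y R) (D : dynamical_system M p) (f : PS_hom p q) : Prop :=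
  forall m : M, as_eq p (PS_comp f (D m)) f.

(* A cocone over a diagram indexed by a one-object category is an invariant
   morphism out of its unique object. *)
Definition is_colimit (M : monoidType) d d' (X : measurableType d)
    (X' : measurableType d') (R : realType) (p : probability X R)
    (p' : probability X' R) (D : dynamical_system M p) (r : PS_hom p p') : Prop :=
  as_invariant D r /\
  forall (e : measure_display) (Y : measurableType e) (q : probability Y R)
    (f : PS_hom p q), as_invariant D f ->
    exists ft : PS_hom p' q, as_eq p (PS_comp ft r) f /\
      forall ft' : PS_hom p' q, as_eq p (PS_comp ft' r) f -> as_eq p' ft' ft.

Definition is_invariant_object (M : monoidType) d d' (X : measurableType d)
    (X' : measurableType d') (R : realType) (p : probability X R)
    (p' : probability X' R) (D : dynamical_system M p) (r : PS_hom p p') : Prop :=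
  is_colimit D r /\
  forall (e : measure_display) (Y : measurableType e) (q : probability Y R)
    (f : PS_hom p q) (ft : PS_hom p' q),
    as_invariant D f -> as_eq p (PS_comp ft r) f ->
    (as_deterministic p f <-> as_deterministic p' ft).

Definition invariant_set (M : monoidType) d (X : measurableType d)
    (R : realType) (p : probability X R) (D : dynamical_system M p) : set (set X) :=
  [set A | measurable A /\
           forall m : M, {ae p, forall x, D m x A = (\1_A x)%:E}].

Definition inv_display (M : monoidType) d (X : measurableType d)
    (R : realType) (p : probability X R) (D : dynamical_system M p) :
  measure_display.
Proof. exact: d. Qed.

(* The underlying set of X, to be equipped with the invariant sigma-algebra. *)
Definition inv_space (M : monoidType) d (X : measurableType d)
    (R : realType) (p : probability X R) (D : dynamical_system M p) : Type := X.

Section invariant_sigma_algebra.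
Context (M : monoidType) d (X : measurableType d) (R : realType)
  (p : probability X R) (D : dynamical_system M p).

Let inv0 : invariant_set D set0.
Proof.
split=> // m; apply: aeW => x.
by rewrite measure0 indicE in_set0.
Qed.

Let invC A : invariant_set D A -> invariant_set D (~` A).
Proof.
move=> [mA iA]; split; first exact: measurableC.
move=> m; apply: filterS (iA m) => x DA.
have DT : D m x [set: X] = 1 by exact: prob_kernel.
have -> : D m x (~` A) = D m x [set: X] - D m x A.
  rewrite -setTD measureD ?setTI//.
  by apply: (@le_lt_trans _ _ 1%E); [rewrite -DT|exact: ltry].
rewrite DA DT !indicE in_setC -EFinB.
by case: (x \in A); rewrite ?subrr ?subr0.
Qed.

Let inv_bigcup (F : (set X)^nat) :
  (forall i, invariant_set D (F i)) -> invariant_set D (\bigcup_i F i).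
Proof.
move=> iF; have mF i : measurable (F i) by case: (iF i).
have mU : measurable (\bigcup_i F i) by exact: bigcupT_measurable.
split=> // m.
have /ae_foralln : forall i, {ae p, forall x, D m x (F i) = (\1_(F i) x)%:E}.
  by move=> i; case: (iF i) => _; exact.
apply: filterS => x DF; rewrite indicE.
have [/set_mem[i _ Fix]|/negP xF] := boolP (x \in \bigcup_i F i).
  apply/eqP; rewrite eq_le; apply/andP; split.
    have <- : D m x [set: X] = 1 by exact: prob_kernel.
    by apply: le_measure; rewrite ?inE.
  have <- : D m x (F i) = 1 by rewrite DF indicE mem_set.
  by apply: le_measure; rewrite ?inE//; exact: bigcup_sup.
apply/eqP; rewrite eq_le measure_ge0 andbT.
apply: (@le_trans _ _ (\sum_(0 <= i <oo) D m x (F i))).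
  exact: measure_sigma_subadditive.
rewrite eseries0// => i _ _; rewrite DF indicE memNset// => Fix.
by apply: xF; apply/mem_set; exists i.
Qed.

HB.instance Definition _ := Pointed.on (inv_space D).
HB.instance Definition _ := @isMeasurable.Build (inv_display D) (inv_space D)
  (invariant_set D) inv0 invC inv_bigcup.

Definition inv_prob : set (inv_space D) -> \bar R := p.

Let inv_prob0 : inv_prob set0 = 0. Proof. exact: measure0. Qed.

Let inv_prob_ge0 A : 0 <= inv_prob A. Proof. exact: measure_ge0. Qed.

Let inv_prob_sigma_additive : semi_sigma_additive inv_prob.
Proof.
by move=> F mF tF [mU _]; apply: measure_semi_sigma_additive => // i; case: (mF i).
Qed.

HB.instance Definition _ := isMeasure.Build _ _ R inv_prob
  inv_prob0 inv_prob_ge0 inv_prob_sigma_additive.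

Let inv_probT : inv_prob setT = 1. Proof. exact: probability_setT. Qed.

HB.instance Definition _ := Measure_isProbability.Build _ _ R inv_prob inv_probT.

Definition to_inv (x : X) : inv_space D := x.

Lemma measurable_to_inv : measurable_fun [set: X] to_inv.
Proof. by move=> _ B [mB _]; rewrite setTI. Qed.

Let proj_kernel : R.-pker X ~> inv_space D := kdirac measurable_to_inv.

Let proj_preserve (B : set (inv_space D)) :
  measurable B -> inv_prob B = \int[p]_x proj_kernel x B.
Proof. by case=> mB _; rewrite /= /dirac integral_indic// setIT. Qed.

Definition inv_proj : PS_hom p inv_prob := PSHom proj_preserve.

End invariant_sigma_algebra.

(* Main.v *)
Require Import Defs.
From HB Require Import structures.
From mathcomp Require Import all_boot all_order all_algebra.
From mathcomp Require Import all_classical all_reals all_analysis.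
From mathcomp Require Import measurable_realfun kernel.
From mathcomp Require Import ring.

Set Implicit Arguments.
Unset Strict Implicit.
Unset Printing Implicit Defensive.

Import Order.TTheory GRing.Theory Num.Theory.

Local Open Scope classical_set_scope.
Local Open Scope ring_scope.
Local Open Scope ereal_scope.

(* Let [f] be invariant and fix a measurable [B]. The function [g x = f x B]
   satisfies [T g = g] almost everywhere for each [T = D m], and since [T]
   preserves [p],
     \int \int (g y - g x)^2 T(dy|x) p(dx)
       = \int T(g^2) - 2 g (T g) + g^2 dp = 0.
   Hence [g = g x] almost surely under [T x], so the level sets of [g] are
   invariant. Null sets being invariant, [g] is itself measurable for the
   invariant sigma-algebra, not just almost everywhere equal to a function that
   is, so [f] is its own factorization through the identity and no regularity
   of its codomain is needed. *)

(** * Almost sure notions in pointwise form *)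

Section almost_everywhere.
Context d (X : measurableType d) (R : realType) (p : probability X R).

(** Being bounded by 1, [g] is integrable for the probability [p], so its integrals over all
    measurable sets determine it almost everywhere. *)
Lemma integral_eq_ae (g h : X -> \bar R) :
  measurable_fun [set: X] g -> measurable_fun [set: X] h ->
  (forall x, 0 <= g x <= 1) -> (forall x, 0 <= h x) ->
  (forall A, measurable A -> \int[p]_(x in A) g x = \int[p]_(x in A) h x) <->
  {ae p, forall x, g x = h x}.
Proof.
move=> mg mh g01 h0; split=> [gh|gh A mA].
  have : ae_eq p [set: X] g h.
    apply: integral_ae_eq => //; last by move=> A _; exact: gh.
    apply: (@le_integrable _ _ _ p setT measurableT g (cst 1)) => //.
      move=> x _; have /andP[g0 g1] := g01 x.
      by rewrite gee0_abs// gee0_abs.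
    exact: finite_measure_integrable_cst.
  by apply: filterS => x; exact.
apply: ge0_ae_eq_integral => //.
- exact: measurable_funTS.
- exact: measurable_funTS.
- by move=> x _; have /andP[] := g01 x.
- by apply: filterS gh => x ->.
Qed.

End almost_everywhere.

Section as_eq_ae.
Context d d' (X : measurableType d) (Y : measurableType d') (R : realType).
Variable p : probability X R.
Implicit Types f g : R.-pker X ~> Y.

Lemma pker_ge0_le1 f x B : measurable B -> 0 <= f x B <= 1.
Proof.
move=> mB; rewrite measure_ge0/=.
by rewrite -(@prob_kernel _ _ _ _ _ f x); apply: le_measure; rewrite ?inE.
Qed.

(** The exceptional null set may depend on [B]. *)
Lemma as_eqP f g : as_eq p f g <->
  forall B, measurable B -> {ae p, forall x, f x B = g x B}.
Proof.
have fgB B : measurable B ->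
    (forall A, measurable A -> \int[p]_(x in A) f x B = \int[p]_(x in A) g x B)
    <-> {ae p, forall x, f x B = g x B}.
  move=> mB; apply: integral_eq_ae => [||x|x //]; rewrite ?pker_ge0_le1//;
    exact: measurable_kernel.
split=> [fg B mB|fg A B mA mB]; first by apply/(fgB _ mB) => A mA; exact: fg.
by move: A mA; apply/(fgB _ mB); exact: fg.
Qed.

Lemma as_deterministicP f : as_deterministic p f <->
  forall B B', measurable B -> measurable B' ->
    {ae p, forall x, f x (B `&` B') = f x B * f x B'}.
Proof.
have fBB' B B' : measurable B -> measurable B' ->
    (forall A, measurable A ->
       \int[p]_(x in A) f x (B `&` B') = \int[p]_(x in A) (f x B * f x B'))
    <-> {ae p, forall x, f x (B `&` B') = f x B * f x B'}.
  move=> mB mB'; have mBB' := measurableI _ _ mB mB'.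
  apply: integral_eq_ae => [||x|x]; rewrite ?pker_ge0_le1 ?mule_ge0//.
    exact: measurable_kernel.
  by apply: emeasurable_funM; exact: measurable_kernel.
split=> [fD B B' mB mB'|fD A B B' mA mB mB'].
  by apply/(fBB' _ _ mB mB') => A mA; exact: fD.
by move: A mA; apply/(fBB' _ _ mB mB'); exact: fD.
Qed.

End as_eq_ae.

(** * Functions fixed by a measure-preserving kernel *)

Section preserved_functions.
Context d (X : measurableType d) (R : realType) (p : probability X R).
Variable T : PS_hom p p.

Lemma preserved_fun_ae_cst (g : X -> R) :
  measurable_fun [set: X] g -> (forall x, 0 <= g x <= 1)%R ->
  {ae p, forall x, \int[T x]_y (g y)%:E = (g x)%:E} ->
  {ae p, forall x, {ae T x, forall y, g y = g x}}.
Proof.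
move=> mg g01 Tg.
have g0 x : (0 <= g x)%R by have /andP[] := g01 x.
(* Where [T g = g], [h x] is the variance of [g] under [T x], and [s x] is its second moment. *)
pose h x := \int[T x]_y ((g y - g x) ^+ 2)%:E.
pose s x := \int[T x]_y (g y ^+ 2)%:E.
have ms2 : measurable_fun [set: X] (fun y => (g y ^+ 2)%:E).
  by apply/measurable_EFinP; exact: measurable_funX.
have mh : measurable_fun [set: X] h.
  apply: (measurable_fun_integral_finite_kernel
    (fun z => ((g z.2 - g z.1) ^+ 2)%:E)) => [z|].
    by rewrite lee_fin sqr_ge0.
  apply/measurable_EFinP/measurable_funX/measurable_funB;
    exact: measurableT_comp.
have ms : measurable_fun [set: X] s.
  apply: measurable_fun_integral_kernel => //.
  - by move=> U mU; exact: measurable_kernel.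
  - by move=> y; rewrite lee_fin sqr_ge0.
have h0 x : 0 <= h x by apply: integral_ge0 => y _; rewrite lee_fin sqr_ge0.
have s0 x : 0 <= s x by apply: integral_ge0 => y _; rewrite lee_fin sqr_ge0.
have sE : \int[p]_x s x = \int[p]_x (g x ^+ 2)%:E.
  by rewrite [RHS](integral_PS_hom T) // => y; rewrite lee_fin sqr_ge0.
(* Expanding the square: [h + g ^ 2 = T (g ^ 2)] almost everywhere. *)
have hsE : {ae p, forall x, h x + (g x ^+ 2)%:E = s x}.
  apply: filterS Tg => x Tgx.
  (* The cross term stands on the left so that all integrands are nonnegative and additivity applies
     without subtraction. *)
  have : h x + (2 * g x)%:E * (g x)%:E = s x + (g x ^+ 2)%:E.
    rewrite -Tgx -ge0_integralZl//; last 3 first.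
    - exact/measurable_EFinP.
    - by move=> y _; rewrite lee_fin.
    - by rewrite lee_fin mulr_ge0.
    rewrite -ge0_integralD//; last 4 first.
    - by move=> y _; rewrite lee_fin sqr_ge0.
    - apply/measurable_EFinP/measurable_funX; exact: measurable_funB.
    - by move=> y _; rewrite -EFinM lee_fin !mulr_ge0.
    - under eq_fun do rewrite -EFinM.
      by apply/measurable_EFinP; exact: measurable_funM.
    have -> : (g x ^+ 2)%:E = \int[T x]_y (g x ^+ 2)%:E.
      by rewrite integral_cst// prob_kernel mule1.
    rewrite -ge0_integralD//; last 2 first.
    - by move=> y _; rewrite lee_fin sqr_ge0.
    - by move=> y _; rewrite lee_fin sqr_ge0.
    by apply: eq_integral => y _; rewrite -EFinM -!EFinD; congr EFin; ring.
  move=> /(congr1 (fun u => u - (g x ^+ 2)%:E)); rewrite addeK// => <-.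
  by rewrite -[RHS]addeA -EFinM -EFinB; congr (_ + _%:E); ring.
have ih : \int[p]_x h x = 0.
  have : \int[p]_x h x + \int[p]_x (g x ^+ 2)%:E = \int[p]_x (g x ^+ 2)%:E.
    rewrite -ge0_integralD//; last first.
      by move=> x _; rewrite lee_fin sqr_ge0.
    rewrite -sE; apply: ge0_ae_eq_integral => //.
    - exact: emeasurable_funD.
    - by move=> x _; rewrite adde_ge0// lee_fin sqr_ge0.
    - by apply: filterS hsE => x ->.
  (* Cancellation in the extended reals needs finiteness, which follows from [g ^ 2 <= 1]. *)
  have fg : \int[p]_x (g x ^+ 2)%:E \is a fin_num.
    rewrite ge0_fin_numE; last first.
      by apply: integral_ge0 => x _; rewrite lee_fin sqr_ge0.
    apply: (@le_lt_trans _ _ (\int[p]_x (cst 1 x))); last first.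
      rewrite integral_cst// mul1e.
      by rewrite (@le_lt_trans _ _ 1)// ?probability_le1// ltry.
    apply: ge0_le_integral => //.
    - by move=> x _; rewrite lee_fin sqr_ge0.
    - move=> x _; rewrite lee_fin.
      by have /andP[? ?] := g01 x; exact: exprn_ile1.
  move=> /(congr1 (fun u => u - \int[p]_x (g x ^+ 2)%:E)).
  by rewrite addeK// subee.
have : ae_eq p [set: X] h (cst 0).
  apply/ae_eq_integral_abs => //.
  by rewrite -ih; apply: eq_integral => x _; rewrite gee0_abs.
(* A nonnegative integrand with zero integral vanishes almost everywhere; this now applies to the
   square under [T x]. *)
apply: filterS => x /(_ Logic.I) hx.
have : ae_eq (T x) [set: X] (fun y => ((g y - g x) ^+ 2)%:E) (cst 0).
  apply/ae_eq_integral_abs => //.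
    apply/measurable_EFinP/measurable_funX; exact: measurable_funB.
  rewrite -[RHS]hx; apply: eq_integral => y _.
  by rewrite gee0_abs// lee_fin sqr_ge0.
apply: filterS => y /(_ Logic.I) [] /eqP.
by rewrite sqrf_eq0 subr_eq0 => /eqP.
Qed.

(** For almost all [x], [T x]-almost every [y] has [g y = g x], hence lies in the preimage exactly
    when [x] does. *)
Lemma preserved_fun_preimage (g : X -> R) (U : set R) :
  measurable_fun [set: X] g -> (forall x, 0 <= g x <= 1)%R ->
  {ae p, forall x, \int[T x]_y (g y)%:E = (g x)%:E} -> measurable U ->
  {ae p, forall x, T x (g @^-1` U) = (\1_(g @^-1` U) x)%:E}.
Proof.
move=> mg g01 Tg mU; apply: filterS (preserved_fun_ae_cst mg g01 Tg) => x gx.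
have mgU : measurable (g @^-1` U) by rewrite -[_ @^-1` _]setTI; exact: mg.
transitivity (\int[T x]_y (\1_(g @^-1` U) y)%:E).
  by rewrite integral_indic// setIT.
rewrite -[RHS]mule1 -(@prob_kernel _ _ _ _ _ T x) -integral_cst//.
apply: ge0_ae_eq_integral => //.
- by apply/measurable_EFinP.
- by move=> y _; rewrite lee_fin.
- apply: filterS gx => y gyx _ /=; congr EFin; rewrite !indicE.
  congr (nat_of_bool _)%:R.
  by apply/idP/idP; rewrite !inE /= gyx.
Qed.

End preserved_functions.

(** * Factorization through the invariant sigma-algebra *)

Section invariant_object.
Context (R : realType) (M : monoidType) d (X : measurableType d)
  (p : probability X R) (D : dynamical_system M p).
Local Notation p_inv := (inv_prob (D := D)).

(* From right to left: measurable null sets are invariant. *)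
Lemma ae_inv_probE (P : X -> Prop) :
  {ae p_inv, forall x, P x} <-> {ae p, forall x, P x}.
Proof.
split=> -[N [mN N0 PN]]; first by exists N; split => //; case: mN.
exists N; split => //; split=> // m.
(* [D m] preserves [p], so [D m x N] integrates to [p N = 0]. *)
have : ae_eq p [set: X] (fun x => D m x N) (cst 0).
  apply/ae_eq_integral_abs => //; first exact: measurable_kernel.
  rewrite -N0 (PS_preserve (D m) mN).
  by apply: eq_integral => x _; rewrite gee0_abs.
have : {ae p, forall x, ~ N x} by exists N; split=> //; move=> x /= /contrapT.
apply: filterS2 => x Nx /(_ Logic.I) ->.
by rewrite indicE memNset.
Qed.

Lemma PS_comp_inv_projE d' (Y : measurableType d') (q : probability Y R)
    (ft : PS_hom p_inv q) x B : measurable B ->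
  PS_comp ft (inv_proj D) x B = ft x B.
Proof.
move=> mB; rewrite /= /mkcomp_noparam/= /kcomp_noparam/= integral_dirac//.
  by rewrite diracT mul1e.
exact: measurable_kernel.
Qed.

Lemma as_eq_comp_inv_projP d' (Y : measurableType d') (q : probability Y R)
    (f : PS_hom p q) (ft : PS_hom p_inv q) :
  as_eq p (PS_comp ft (inv_proj D)) f <->
  forall B, measurable B -> {ae p, forall x : X, ft x B = f x B}.
Proof.
split=> [/as_eqP ftf B mB|ftf].
  by apply: filterS (ftf B mB) => x; rewrite PS_comp_inv_projE.
apply/as_eqP => B mB.
by apply: filterS (ftf B mB) => x; rewrite PS_comp_inv_projE.
Qed.

Lemma as_invariant_inv_proj : as_invariant D (inv_proj D).
Proof.
move=> m; apply/as_eqP => B [mB iB]; apply: filterS (iB m) => x mxB.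
rewrite /= /mkcomp_noparam/= /kcomp_noparam/=.
by rewrite /dirac integral_indic// setIT.
Qed.

(** Invariance of [f] says that [D m] fixes [x |-> f x B] almost everywhere, so preimages of Borel
    sets under it are invariant sets. *)
Lemma as_invariant_measurable d' (Y : measurableType d') (q : probability Y R)
    (f : PS_hom p q) B : as_invariant D f -> measurable B ->
  measurable_fun [set: inv_space D] (fun x : inv_space D => f x B).
Proof.
move=> fD mB.
have mf : measurable_fun [set: X] (fun x => fine (f x B)).
  by apply: measurableT_comp => //; exact: measurable_kernel.
have fE x : (fine (f x B))%:E = f x B.
  have /andP[f0 f1] := pker_ge0_le1 f x mB.
  by rewrite fineK// ge0_fin_numE// (le_lt_trans f1)// ltry.
(* [fine] gives the real-valued function on which [preserved_fun_preimage] acts; the values lie in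
   [0, 1], so nothing is lost. *)
rewrite (_ : (fun _ => _) = EFin \o (fun x => fine (f x B))); last first.
  by apply/funext => x /=; rewrite fE.
apply/measurable_EFinP => _ U mU; rewrite setTI; split.
  by rewrite -[X in measurable X]setTI; exact: mf.
move=> m; apply: preserved_fun_preimage => // [x|].
  by have := pker_ge0_le1 f x mB; rewrite -fE !lee_fin.
have /as_eqP/(_ B mB) := fD m; apply: filterS => x fmx; rewrite fE -fmx.
by apply: eq_integral => y _; rewrite fE.
Qed.

(** The measures [f x] are kept; only measurability in [x] and preservation of the measure are
    checked anew on the coarser space. *)
Lemma as_invariant_descends d' (Y : measurableType d') (q : probability Y R)
    (f : PS_hom p q) : as_invariant D f ->
  exists ft : PS_hom p_inv q, forall x B, ft x B = f x B.
Proof.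
move=> fD.
pose k (x : inv_space D) : {measure set Y -> \bar R} := f x.
pose mk := isKernel.Build _ _ _ _ R k
  (fun B mB => as_invariant_measurable fD mB).
pose pk := Kernel_isProbability.Build _ _ _ _ R
  (HB.pack_for (R.-ker _ ~> _) k mk) (fun x => @prob_kernel _ _ _ _ _ f x).
pose ft : R.-pker (inv_space D) ~> Y := HB.pack k mk pk.
have ft_preserve B : measurable B -> q B = \int[p_inv]_x ft x B.
  move=> mB; rewrite (PS_preserve f mB).
  (* Change of variables along [inv_proj D], which sends [p] to [p_inv]. *)
  rewrite (integral_PS_hom (inv_proj D))//; last first.
    exact: measurable_kernel.
  apply: eq_integral => x _; rewrite integral_dirac//.
    by rewrite diracT mul1e.
  exact: measurable_kernel.
by exists (PSHom ft_preserve).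
Qed.

End invariant_object.

Theorem theorem3p5 (R : realType) (M : monoidType) (d : measure_display)
    (X : measurableType d) (p : probability X R) (D : dynamical_system M p) :
  is_invariant_object D (inv_proj D).
Proof.
split; first split; first exact: as_invariant_inv_proj.
- move=> e Y q f fD; have [ft ftE] := as_invariant_descends fD.
  exists ft; split.
    by apply/as_eq_comp_inv_projP => B mB; apply: aeW => x; exact: ftE.
  (* Uniqueness: [ft'] agrees with [f], hence with [ft], off a [p]-null set, and [p] and [p_inv]
     have the same almost everywhere statements. *)
  move=> ft' /as_eq_comp_inv_projP ft'f; apply/as_eqP => B mB.
  by apply/ae_inv_probE; apply: filterS (ft'f B mB) => x ->.
- move=> e Y q f ft _ /as_eq_comp_inv_projP ftf.
  suff fft B B' : measurable B -> measurable B' ->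
      {ae p, forall x, f x (B `&` B') = f x B * f x B'} <->
      {ae inv_prob (D := D), forall x, ft x (B `&` B') = ft x B * ft x B'}.
    by split=> /as_deterministicP fD; apply/as_deterministicP => B B' mB mB';
      apply/(fft _ _ mB mB'); exact: fD.
  move=> mB mB'; have mBB' := measurableI _ _ mB mB'.
  (* Off one null set, [ft x] and [f x] agree on all three sets in the multiplicativity equation. *)
  have fftE : {ae p, forall x : X, [/\ ft x B = f x B, ft x B' = f x B' &
      ft x (B `&` B') = f x (B `&` B')]}.
    by apply: filterS3 (ftf B mB) (ftf B' mB') (ftf _ mBB').
  rewrite ae_inv_probE.
  by split; apply: filterS2 fftE => x [-> -> ->].
Qed.
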